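(* For all integers $m,n\ge1$, all functions $\Psi_1,\dots,\Psi_m:\mathbb{Z}^n\to\mathbb{R}_{>0}$ and each $\circ\in\{\ ,\ ',\ ''\}$, the set $\mathcal{F}^\circ_{n,m}(\Psi_1,\dots,\Psi_m)=\bigcup_{k=1}^\infty\mathcal{A}^\circ_{n,m}(k\Psi_1,\dots,k\Psi_m)$ has Lebesgue measure $0$ or $1$.
   Context: Let $m,n\ge1$ be integers. Points $\mathbf{X}\in[0,1]^{nm}$ are regarded as real $n\times m$ matrices with columns $\mathbf{X}^{(1)},\dots,\mathbf{X}^{(m)}$, and $\mathbf{q}\in\mathbb{Z}^n$ as a row vector. For $\Psi_1,\dots,\Psi_m:\mathbb{Z}^n\to\mathbb{R}_{>0}$ consider the system ( ** ) $|\mathbf{q}\mathbf{X}^{(j)}+p_j|<\Psi_j(\mathbf{q})$ for all $j=1,\dots,m$, with $\mathbf{p}=(p_1,\dots,p_m)\in\mathbb{Z}^m$, $\mathbf{q}\in\mathbb{Z}^n\setminus\{\mathbf{0}\}$. $\mathcal{A}_{n,m}(\Psi_1,\dots,\Psi_m)$ is the set of $\mathbf{X}\in[0,1]^{nm}$ for which ( ** ) holds for infinitely many $(\mathbf{p},\mathbf{q})$; $\mathcal{A}'_{n,m}(\Psi_1,\dots,\Psi_m)$ is the same with the additional requirement $\gcd(\mathbf{p},\mathbf{q})=1$ (gcd of all components of $\mathbf{p}$ and $\mathbf{q}$); $\mathcal{A}''_{n,m}(\Psi_1,\dots,\Psi_m)$ is the same with the additional requirement $\gcd(p_j,\mathbf{q})=1$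 for every $j=1,\dots,m$. $\mathcal{A}^\circ_{n,m}$ denotes any one of these three sets, and $k\Psi_j$ is $\mathbf{q}\mapsto k\Psi_j(\mathbf{q})$. *)

(* Defs.v *)
From Stdlib Require Import Reals ZArith List Lra.
Import ListNotations.
Open Scope R_scope.

(** Conventions.
    - A point X of [0,1]^{nm} is a function X : nat -> nat -> R; only the
      entries X i j with i < n, j < m are relevant (row i, column j).
    - q in Z^n is a list of integers of length n (row vector), p in Z^m is a
      list of integers of length m.
    - Psi : nat -> list Z -> R, Psi j is Psi_{j+1} (j = 0..m-1), evaluated
      on q in Z^n (lists of length n). *)

Inductive variant := Plain | Prime | DPrime.

Fixpoint sumR (f : nat -> R) (N : nat) : R :=
  match N with O => 0 | S N' => sumR f N' + f N' end.

Fixpoint prodR (f : nat -> R) (N : nat) : R :=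
  match N with O => 1 | S N' => prodR f N' * f N' end.

Definition qXcol (n : nat) (q : list Z) (X : nat -> nat -> R) (j : nat) : R :=
  sumR (fun i => IZR (nth i q 0%Z) * X i j) n.

Definition gcd_list (l : list Z) : Z := fold_right Z.gcd 0%Z l.

Definition gcd_cond (c : variant) (m : nat) (p q : list Z) : Prop :=
  match c with
  | Plain => True
  | Prime => gcd_list (p ++ q) = 1%Z
  | DPrime => forall j, (j < m)%nat -> gcd_list (nth j p 0%Z :: q) = 1%Z
  end.

Definition is_solution (c : variant) (n m : nat) (Psi : nat -> list Z -> R)
    (k : R) (X : nat -> nat -> R) (p q : list Z) : Prop :=
  length q = n /\ length p = m /\
  Exists (fun z => z <> 0%Z) q /\
  (forall j, (j < m)%nat ->
     Rabs (qXcol n q X j + IZR (nth j p 0%Z)) < k * Psi j q) /\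
  gcd_cond c m p q.

Definition in_unit_cube (n m : nat) (X : nat -> nat -> R) : Prop :=
  forall i j, (i < n)%nat -> (j < m)%nat -> 0 <= X i j <= 1.

(** A^c_{n,m}(k Psi_1, ..., k Psi_m): X in [0,1]^{nm} with infinitely many
    solutions (p,q), i.e. no finite list contains all solutions. *)
Definition A_set (c : variant) (n m : nat) (Psi : nat -> list Z -> R) (k : R)
    (X : nat -> nat -> R) : Prop :=
  in_unit_cube n m X /\
  ~ (exists L : list (list Z * list Z),
        forall p q, is_solution c n m Psi k X p q -> In (p, q) L).

Definition F_set (c : variant) (n m : nat) (Psi : nat -> list Z -> R)
    (X : nat -> nat -> R) : Prop :=
  exists k : nat, (1 <= k)%nat /\ A_set c n m Psi (INR k) X.

(** Lebesgue (outer) measure on R^{nm}, defined via countable covers by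
    closed boxes: boxes indexed by l : nat, with corners a l, b l. *)
Definition box_volume (n m : nat) (a b : nat -> nat -> R) : R :=
  prodR (fun i => prodR (fun j => b i j - a i j) m) n.

Definition cover_sum (n m : nat) (S : (nat -> nat -> R) -> Prop) (s : R) : Prop :=
  exists a b : nat -> nat -> nat -> R,
    (forall l i j, (i < n)%nat -> (j < m)%nat -> a l i j <= b l i j) /\
    (forall X, S X -> exists l, forall i j, (i < n)%nat -> (j < m)%nat ->
        a l i j <= X i j <= b l i j) /\
    infinite_sum (fun l => box_volume n m (a l) (b l)) s.

Definition is_inf (E : R -> Prop) (r : R) : Prop :=
  (forall s, E s -> r <= s) /\
  (forall r', (forall s, E s -> r' <= s) -> r' <= r).

Definition lebesgue_outer_measure (n m : nat) (S : (nat -> nat -> R) -> Prop)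
    (r : R) : Prop :=
  is_inf (cover_sum n m S) r.

(* Main.v *)
Require Import Defs.
From Stdlib Require Import Reals ZArith Znumtheory List Lra Lia Classical ClassicalEpsilon
  FunctionalExtensionality PropExtensionality FinFun Cantor IndefiniteDescription.
Import ListNotations.
Open Scope R_scope.

(** Let [G] be the set of all real matrices that satisfy the defining property of F°, and
    [r] the outer measure of its part in the unit cube. If arbitrarily fine grids exist such
    that [G] has measure at most [r * vol C] in every grid cube [C], the same bound holds for
    every box, so a cover of the unit part by boxes of total volume [s] gives [r <= r * s];
    hence [r = 0], or every cover has volume at least 1. No measurability is needed.

    To obtain such grids, split the solutions by the exact power [2^e] of 2 dividing [q] and
    by a coordinate [i0] of [q] attaining it. For each such class the set is mapped into
    itself by [X -> 2X + V], where [V] has entries [2^-e] in row [i0]: [(p, q)] becomes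
    [(2p - qV, q)] and [qV] is odd, so no common factor 2 appears. The iterates of this map
    blow the cubes of a grid of side [2^-k] up to unit cubes, so each class obeys the
    zero-one law. If all classes are null, then up to a null set only solutions with
    [2^(e+1)] dividing [q] matter; for these, translations by [2^-e Z^nm] change [p] by even
    multiples of [q / 2^(e+1)] and preserve the coprimality conditions, so all cubes of side
    [2^-e] carry the same share of [r]. *)

(** * Finite sums and the Cantor enumeration of double sums *)

Lemma sumR_le (f g : nat -> R) (N : nat) :
  (forall l, f l <= g l) -> sumR f N <= sumR g N.
Proof. intros H; induction N as [|N IH]; simpl; [lra|]. specialize (H N); lra. Qed.

Lemma sumR_ext (f g : nat -> R) (N : nat) :
  (forall l, (l < N)%nat -> f l = g l) -> sumR f N = sumR g N.
Proof.
  intros H; induction N as [|N IH]; simpl; [lra|].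
  rewrite IH, H by (auto with arith); reflexivity.
Qed.

Lemma sumR_plus (f g : nat -> R) (N : nat) :
  sumR (fun l => f l + g l) N = sumR f N + sumR g N.
Proof. induction N as [|N IH]; simpl; lra. Qed.

Lemma sumR_scal (c : R) (f : nat -> R) (N : nat) :
  sumR (fun l => c * f l) N = c * sumR f N.
Proof. induction N as [|N IH]; simpl; [lra|]. rewrite IH; lra. Qed.

Lemma sumR_mono (f : nat -> R) (N M : nat) :
  (forall l, 0 <= f l) -> (N <= M)%nat -> sumR f N <= sumR f M.
Proof.
  intros H HNM; induction HNM as [|M _ IH]; simpl; [lra|].
  specialize (H M); lra.
Qed.

Lemma sumR_half_pow (N : nat) : sumR (fun l => (/ 2) ^ S l) N = 1 - (/ 2) ^ N.
Proof. induction N as [|N IH]; simpl in *; [lra|]. rewrite IH; lra. Qed.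

Lemma sumR_half_pow_le (N : nat) : sumR (fun l => (/ 2) ^ S l) N <= 1.
Proof. rewrite sumR_half_pow. assert (0 <= (/ 2) ^ N) by (apply pow_le; lra). lra. Qed.

Definition sumL {T : Type} (f : T -> R) (L : list T) : R :=
  fold_right (fun x s => f x + s) 0 L.

Lemma sumL_app {T : Type} (f : T -> R) (L L' : list T) :
  sumL f (L ++ L') = sumL f L + sumL f L'.
Proof. induction L as [|x L IH]; simpl; [lra|]. rewrite IH; lra. Qed.

Lemma sumL_map {T U : Type} (f : U -> R) (g : T -> U) (L : list T) :
  sumL f (map g L) = sumL (fun x => f (g x)) L.
Proof. induction L as [|x L IH]; simpl; [lra|]. rewrite IH; lra. Qed.

Lemma sumL_nonneg {T : Type} (f : T -> R) (L : list T) :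
  (forall x, 0 <= f x) -> 0 <= sumL f L.
Proof. intros H; induction L as [|x L IH]; simpl; [lra|]. specialize (H x); lra. Qed.

Lemma sumL_incl {T : Type} (f : T -> R) (L L' : list T) :
  (forall x, 0 <= f x) -> NoDup L -> incl L L' -> sumL f L <= sumL f L'.
Proof.
  intros Hf HL; revert L'; induction HL as [|x L Hx HL IH]; intros L' Hi; simpl.
  - now apply sumL_nonneg.
  - destruct (in_split x L' (Hi x (or_introl eq_refl))) as (A & B & ->).
    assert (sumL f L <= sumL f (A ++ B)).
    { apply IH. intros y Hy. specialize (Hi y (or_intror Hy)).
      apply in_app_or in Hi as [Hi|[Hi|Hi]]; apply in_or_app; auto.
      subst; contradiction. }
    rewrite sumL_app in *; simpl; lra.
Qed.

Lemma sumR_sumL (f : nat -> R) (N : nat) : sumR f N = sumL f (seq 0 N).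
Proof.
  induction N as [|N IH]; [reflexivity|].
  rewrite seq_S, sumL_app; simpl; rewrite IH; lra.
Qed.

Lemma sumL_list_prod {T U : Type} (f : T * U -> R) (L : list T) (L' : list U) :
  sumL f (list_prod L L') = sumL (fun x => sumL (fun y => f (x, y)) L') L.
Proof.
  induction L as [|x L IH]; simpl; [lra|].
  rewrite sumL_app, sumL_map, IH; lra.
Qed.

Lemma NoDup_map_of_nat (N : nat) : NoDup (map Cantor.of_nat (seq 0 N)).
Proof.
  apply Injective_map_NoDup; [|apply seq_NoDup].
  intros x y H. apply (f_equal Cantor.to_nat) in H.
  now rewrite !Cantor.cancel_to_of in H.
Qed.

(** A Cantor code is at least as large as both of its components, so the first [N] codes are
    distinct points of the square of side [N]; the remaining terms of the square are nonnegative. *)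
Lemma sumR_cantor_le (v : nat -> nat -> R) (N : nat) :
  (forall l c, 0 <= v l c) ->
  sumR (fun k => v (fst (Cantor.of_nat k)) (snd (Cantor.of_nat k))) N
  <= sumR (fun l => sumR (v l) N) N.
Proof.
  intros Hv.
  set (w := fun p : nat * nat => v (fst p) (snd p)).
  rewrite !sumR_sumL.
  transitivity (sumL w (map Cantor.of_nat (seq 0 N))).
  { rewrite sumL_map; right; reflexivity. }
  transitivity (sumL w (list_prod (seq 0 N) (seq 0 N))).
  - apply sumL_incl; [intros; apply Hv|apply NoDup_map_of_nat|].
    intros p Hp. apply in_map_iff in Hp as (k & <- & Hk).
    apply in_seq in Hk.
    destruct (Cantor.of_nat k) as [x y] eqn:E.
    pose proof (Cantor.to_nat_non_decreasing x y) as Hle.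
    rewrite <- E, Cantor.cancel_to_of in Hle.
    apply in_prod; apply in_seq; lia.
  - rewrite sumL_list_prod. right.
    rewrite <- (sumR_sumL (fun x => sumL (fun y => w (x, y)) (seq 0 N))).
    rewrite <- (sumR_sumL (fun l => sumR (v l) N)).
    apply sumR_ext. intros l _. now rewrite sumR_sumL.
Qed.

(** * Outer measure by countable covers with boxes *)

(** Equality on the index type is decided classically, so [I] can stay arbitrary. *)
Definition upd {I T : Type} (a : I -> T) (j : I) (x : T) : I -> T :=
  fun i => if excluded_middle_informative (i = j) then x else a i.

Lemma upd_eq {I T : Type} (a : I -> T) (j : I) (x : T) : upd a j x j = x.
Proof. unfold upd. destruct (excluded_middle_informative (j = j)); congruence. Qed.

Lemma upd_neq {I T : Type} (a : I -> T) (i j : I) (x : T) : i <> j -> upd a j x i = a i.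
Proof. unfold upd. destruct (excluded_middle_informative (i = j)); congruence. Qed.

Definition vol {I : Type} (idx : list I) (a b : I -> R) : R :=
  fold_right (fun i v => (b i - a i) * v) 1 idx.

Definition box_le {I : Type} (idx : list I) (a b : I -> R) : Prop :=
  forall i, In i idx -> a i <= b i.

Definition inbox {I : Type} (idx : list I) (a b X : I -> R) : Prop :=
  forall i, In i idx -> a i <= X i <= b i.

Lemma vol_ext {I : Type} (idx : list I) (a b a' b' : I -> R) :
  (forall i, In i idx -> b i - a i = b' i - a' i) -> vol idx a b = vol idx a' b'.
Proof.
  induction idx as [|i idx IH]; intros H; simpl; [reflexivity|].
  f_equal; [apply H; now left|]. apply IH. intros k Hk. apply H. now right.
Qed.

Lemma vol_nonneg {I : Type} (idx : list I) (a b : I -> R) :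
  box_le idx a b -> 0 <= vol idx a b.
Proof.
  induction idx as [|i idx IH]; intros H; simpl; [lra|].
  apply Rmult_le_pos.
  - specialize (H i (or_introl eq_refl)); lra.
  - apply IH. intros k Hk. apply H. now right.
Qed.

Lemma vol_const {I : Type} (idx : list I) (a b : I -> R) (d : R) :
  (forall i, In i idx -> b i - a i = d) -> vol idx a b = d ^ length idx.
Proof.
  induction idx as [|i idx IH]; intros H; simpl; [reflexivity|].
  f_equal; [apply H; now left|]. apply IH. intros k Hk. apply H. now right.
Qed.

Lemma vol_scal {I : Type} (idx : list I) (a b a' b' : I -> R) (d : R) :
  (forall i, In i idx -> b' i - a' i = d * (b i - a i)) ->
  vol idx a' b' = d ^ length idx * vol idx a b.
Proof.
  induction idx as [|i idx IH]; intros H; simpl; [lra|].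
  rewrite H by (simpl; auto). rewrite IH by (intros; apply H; simpl; auto). ring.
Qed.

(** [K] is the product of the other side lengths; [NoDup] ensures that side [j] enters the product
    only once. Volume is thus linear in one side, which is what cutting and gluing boxes require. *)
Lemma vol_upd {I : Type} (idx : list I) (j : I) (a b : I -> R) :
  NoDup idx -> In j idx ->
  exists K, (forall x y, vol idx (upd a j x) (upd b j y) = (y - x) * K) /\
            vol idx a b = (b j - a j) * K.
Proof.
  intros Hnd Hj.
  assert (exists K, forall x y, vol idx (upd a j x) (upd b j y) = (y - x) * K)
    as [K HK].
  { induction Hnd as [|i idx Hi Hnd IH]; [destruct Hj|].
    destruct (classic (i = j)) as [->|Hij].
    - exists (vol idx a b). intros x y; simpl. rewrite !upd_eq. f_equal.
      apply vol_ext. intros k Hk.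
      rewrite !upd_neq by (intros ->; contradiction). reflexivity.
    - destruct Hj as [Hj|Hj]; [contradiction|].
      destruct (IH Hj) as [K HK]. exists ((b i - a i) * K).
      intros x y; simpl. rewrite HK, !upd_neq by assumption. ring. }
  exists K; split; [exact HK|].
  rewrite <- HK. apply vol_ext. intros k _.
  destruct (classic (k = j)) as [->|Hk].
  - now rewrite !upd_eq.
  - now rewrite !upd_neq.
Qed.

(** Bounding all partial sums, instead of prescribing the limit, makes this monotone in [s] and
    spares convergence arguments until the link with [cover_sum]. *)
Definition cov {I : Type} (idx : list I) (S : (I -> R) -> Prop) (s : R) : Prop :=
  exists a b : nat -> I -> R,
    (forall l, box_le idx (a l) (b l)) /\
    (forall X, S X -> exists l, inbox idx (a l) (b l) X) /\
    (forall N, sumR (fun l => vol idx (a l) (b l)) N <= s).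

Lemma cov_nonneg {I : Type} (idx : list I) (S : (I -> R) -> Prop) (s : R) :
  cov idx S s -> 0 <= s.
Proof. intros (a & b & _ & _ & H). exact (H 0%nat). Qed.

Lemma cov_mono {I : Type} (idx : list I) (S S' : (I -> R) -> Prop) (s s' : R) :
  (forall X, S' X -> S X) -> s <= s' -> cov idx S s -> cov idx S' s'.
Proof.
  intros HS Hs (a & b & H1 & H2 & H3). exists a, b. repeat split; auto.
  intros N; specialize (H3 N); lra.
Qed.

Lemma cov_countable_union {I : Type} (idx : list I) (S : nat -> (I -> R) -> Prop)
    (s : nat -> R) (t : R) :
  (forall l, cov idx (S l) (s l)) -> (forall N, sumR s N <= t) ->
  cov idx (fun X => exists l, S l X) t.
Proof.
  intros H Ht.
  destruct (functional_choice _ H) as [a Ha].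
  destruct (functional_choice _ Ha) as [b Hb].
  exists (fun k => a (fst (Cantor.of_nat k)) (snd (Cantor.of_nat k))),
         (fun k => b (fst (Cantor.of_nat k)) (snd (Cantor.of_nat k))).
  repeat split.
  - intros k. apply Hb.
  - intros X [l Hl]. destruct (Hb l) as (_ & Hc & _).
    destruct (Hc X Hl) as [c Hin].
    exists (Cantor.to_nat (l, c)). now rewrite Cantor.cancel_of_to.
  - intros N.
    pose proof (sumR_cantor_le (fun l c => vol idx (a l c) (b l c)) N) as HC.
    cbv beta in HC.
    assert (sumR (fun l => sumR (fun c => vol idx (a l c) (b l c)) N) N <= sumR s N).
    { apply sumR_le. intros l. apply Hb. }
    specialize (Ht N).
    assert (forall l c, 0 <= vol idx (a l c) (b l c)).
    { intros l c. apply vol_nonneg, Hb. }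
    specialize (HC H1). lra.
Qed.

(** Outer measure at most [s], phrased without an infimum so that its existence need not be carried
    along. *)
Definition mle {I : Type} (idx : list I) (S : (I -> R) -> Prop) (s : R) : Prop :=
  forall eps, 0 < eps -> cov idx S (s + eps).

Lemma mle_mono {I : Type} (idx : list I) (S S' : (I -> R) -> Prop) (s s' : R) :
  (forall X, S' X -> S X) -> s <= s' -> mle idx S s -> mle idx S' s'.
Proof.
  intros HS Hs H eps He. apply (cov_mono idx S S' (s + eps)); auto. lra.
Qed.

Lemma mle_of_gt {I : Type} (idx : list I) (S : (I -> R) -> Prop) (s : R) :
  (forall s', s < s' -> mle idx S s') -> mle idx S s.
Proof.
  intros H eps He. replace (s + eps) with (s + eps / 2 + eps / 2) by lra.
  apply H; lra.
Qed.

Lemma mle_countable_union {I : Type} (idx : list I) (S : nat -> (I -> R) -> Prop)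
    (s : nat -> R) (t : R) :
  (forall l, mle idx (S l) (s l)) -> (forall N, sumR s N <= t) ->
  mle idx (fun X => exists l, S l X) t.
Proof.
  intros H Ht eps He.
  (* The [l]-th set gets the slack [eps / 2^(l+1)]; all slacks together stay below [eps]. *)
  apply (cov_countable_union idx S (fun l => s l + eps * (/ 2) ^ (Datatypes.S l))).
  - intros l. apply H. apply Rmult_lt_0_compat; [lra|]. apply pow_lt; lra.
  - intros N. rewrite sumR_plus, sumR_scal.
    specialize (Ht N). pose proof (sumR_half_pow_le N).
    pose proof (Rmult_le_compat_l eps _ _ (Rlt_le _ _ He) H0). lra.
Qed.

Lemma cov_box {I : Type} (idx : list I) (a b : I -> R) :
  idx <> [] -> box_le idx a b -> cov idx (inbox idx a b) (vol idx a b).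
Proof.
  intros Hne Hab.
  (* All boxes after the first are the degenerate box at the corner [a]. Its volume is 0 only
     because [idx] is nonempty: an empty product would be 1. *)
  exists (fun l => match l with O => a | _ => a end),
         (fun l => match l with O => b | _ => a end).
  repeat split.
  - intros [|l]; [exact Hab|]. intros i _; lra.
  - intros X HX. exists 0%nat; exact HX.
  - intros N. assert (Hv := vol_nonneg idx a b Hab).
    destruct N as [|N]; [exact Hv|].
    assert (H0 : vol idx a a = 0).
    { rewrite (vol_const idx a a 0) by (intros; lra).
      destruct idx; [congruence|]. simpl; lra. }
    enough (sumR (fun l => vol idx (match l with O => a | _ => a end)
             (match l with O => b | _ => a end)) (S N) = vol idx a b) by lra.
    induction N as [|N IH]; [simpl; lra|].
    change (sumR (fun l => vol idx (match l with O => a | _ => a end)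
             (match l with O => b | _ => a end)) (S N) + vol idx a a = vol idx a b).
    lra.
Qed.

Lemma mle_False {I : Type} (idx : list I) :
  idx <> [] -> mle idx (fun _ => False) 0.
Proof.
  intros Hne eps He.
  apply (cov_mono idx (inbox idx (fun _ => 0) (fun _ => 0)) _ (vol idx (fun _ => 0) (fun _ => 0))).
  - contradiction.
  - rewrite (vol_const idx _ _ 0) by (intros; lra).
    destruct idx; [congruence|]. simpl; lra.
  - apply cov_box; [exact Hne|]. intros i _; lra.
Qed.

Lemma mle_union {I : Type} (idx : list I) (S S' : (I -> R) -> Prop) (s s' : R) :
  idx <> [] -> 0 <= s -> 0 <= s' ->
  mle idx S s -> mle idx S' s' -> mle idx (fun X => S X \/ S' X) (s + s').
Proof.
  intros Hne Hs Hs' HS HS'.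
  apply (mle_mono idx (fun X => exists l : nat,
      match l with O => S X | 1%nat => S' X | _ => False end) _ (s + s')).
  - intros X [H|H]; [exists 0%nat|exists 1%nat]; exact H.
  - lra.
  - apply (mle_countable_union idx (fun (l : nat) X =>
        match l with O => S X | 1%nat => S' X | _ => False end)
      (fun l => match l with O => s | 1%nat => s' | _ => 0 end)).
    + intros [|[|l]]; auto. now apply mle_False.
    + intros [|[|N]]; simpl; try lra.
      induction N as [|N IH]; simpl; lra.
Qed.

(** * Affine images, cutting and halving *)

Lemma cov_affine {I : Type} (idx : list I) (S : (I -> R) -> Prop) (s d : R) (c : I -> R) :
  0 < d -> cov idx S s ->
  cov idx (fun X => S (fun i => / d * (X i - c i))) (d ^ length idx * s).
Proof.
  intros Hd (a & b & H1 & H2 & H3).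
  exists (fun l i => c i + d * a l i), (fun l i => c i + d * b l i).
  repeat split.
  - intros l i Hi. specialize (H1 l i Hi). simpl. nra.
  - intros X HX. destruct (H2 _ HX) as [l Hl]. exists l. intros i Hi.
    specialize (Hl i Hi). simpl in Hl.
    assert (E : X i = c i + d * (/ d * (X i - c i))) by (field; lra).
    rewrite E. split; apply Rplus_le_compat_l, Rmult_le_compat_l; lra.
  - intros N.
    rewrite (sumR_ext _ (fun l => d ^ length idx * vol idx (a l) (b l))).
    + rewrite sumR_scal. apply Rmult_le_compat_l; [|apply H3].
      apply pow_le; lra.
    + intros l _. apply vol_scal. intros; ring.
Qed.

Lemma mle_affine {I : Type} (idx : list I) (S : (I -> R) -> Prop) (s d : R) (c : I -> R) :
  0 < d -> mle idx S s ->
  mle idx (fun X => S (fun i => / d * (X i - c i))) (d ^ length idx * s).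
Proof.
  intros Hd H eps He.
  assert (Hp : 0 < d ^ length idx) by (apply pow_lt; lra).
  replace (d ^ length idx * s + eps) with (d ^ length idx * (s + eps / d ^ length idx))
    by (field; lra).
  apply cov_affine; [lra|]. apply H. apply Rdiv_lt_0_compat; lra.
Qed.

Lemma mle_translate {I : Type} (idx : list I) (S : (I -> R) -> Prop) (s : R) (c : I -> R) :
  mle idx S s -> mle idx (fun X => S (fun i => X i - c i)) s.
Proof.
  intros H. pose proof (mle_affine idx S s 1 c ltac:(lra) H) as H'.
  rewrite pow1, Rmult_1_l in H'.
  eapply mle_mono; [|apply Rle_refl|exact H'].
  intros X HX. cbv beta.
  replace (fun i => / 1 * (X i - c i)) with (fun i => X i - c i); [exact HX|].
  apply functional_extensionality; intros i. field.
Qed.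

(** A hyperplane cuts every box of a cover into two boxes whose volumes add up,
    so one of the two sides has at most half of the total volume. *)
Lemma cov_cut {I : Type} (idx : list I) (S : (I -> R) -> Prop) (s : R) (j : I) (c : R) :
  NoDup idx -> In j idx -> cov idx S s ->
  cov idx (fun X => S X /\ X j <= c) (s / 2) \/
  cov idx (fun X => S X /\ c <= X j) (s / 2).
Proof.
  intros Hnd Hj (a & b & H1 & H2 & H3).
  set (a0 := fun l => upd (a l) j (Rmin (a l j) c)).
  set (b0 := fun l => upd (b l) j (Rmin (b l j) c)).
  set (a1 := fun l => upd (a l) j (Rmax (a l j) c)).
  set (b1 := fun l => upd (b l) j (Rmax (b l j) c)).
  assert (L0 : forall l, box_le idx (a0 l) (b0 l)).
  { intros l i Hi. unfold a0, b0. destruct (classic (i = j)) as [->|Hij].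
    - rewrite !upd_eq. specialize (H1 l j Hj).
      unfold Rmin; destruct (Rle_dec _ _), (Rle_dec _ _); lra.
    - rewrite !upd_neq by assumption. now apply H1. }
  assert (L1 : forall l, box_le idx (a1 l) (b1 l)).
  { intros l i Hi. unfold a1, b1. destruct (classic (i = j)) as [->|Hij].
    - rewrite !upd_eq. specialize (H1 l j Hj).
      unfold Rmax; destruct (Rle_dec _ _), (Rle_dec _ _); lra.
    - rewrite !upd_neq by assumption. now apply H1. }
  assert (V : forall l, vol idx (a0 l) (b0 l) + vol idx (a1 l) (b1 l)
                        = vol idx (a l) (b l)).
  { intros l. destruct (vol_upd idx j (a l) (b l) Hnd Hj) as (K & HK & HK').
    unfold a0, b0, a1, b1. rewrite !HK, HK', <- Rmult_plus_distr_r. f_equal.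
    unfold Rmin, Rmax; destruct (Rle_dec (a l j) c), (Rle_dec (b l j) c); lra. }
  assert (C0 : forall X, S X /\ X j <= c -> exists l, inbox idx (a0 l) (b0 l) X).
  { intros X [HX Hc]. destruct (H2 X HX) as [l Hl]. exists l.
    intros i Hi. specialize (Hl i Hi). unfold a0, b0.
    destruct (classic (i = j)) as [->|Hij].
    - rewrite !upd_eq. unfold Rmin; destruct (Rle_dec _ _), (Rle_dec _ _); lra.
    - now rewrite !upd_neq by assumption. }
  assert (C1 : forall X, S X /\ c <= X j -> exists l, inbox idx (a1 l) (b1 l) X).
  { intros X [HX Hc]. destruct (H2 X HX) as [l Hl]. exists l.
    intros i Hi. specialize (Hl i Hi). unfold a1, b1.
    destruct (classic (i = j)) as [->|Hij].
    - rewrite !upd_eq. unfold Rmax; destruct (Rle_dec _ _), (Rle_dec _ _); lra.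
    - now rewrite !upd_neq by assumption. }
  destruct (classic (forall N, sumR (fun l => vol idx (a0 l) (b0 l)) N <= s / 2)) as [Y|Y].
  { left. exists a0, b0. auto. }
  destruct (classic (forall N, sumR (fun l => vol idx (a1 l) (b1 l)) N <= s / 2)) as [Y'|Y'].
  { right. exists a1, b1. auto. }
  exfalso.
  apply not_all_ex_not in Y as [N HN]. apply not_all_ex_not in Y' as [M HM].
  pose proof (H3 (Nat.max N M)) as HS.
  rewrite (sumR_ext _ (fun l => vol idx (a0 l) (b0 l) + vol idx (a1 l) (b1 l))) in HS
    by (intros; now rewrite V).
  rewrite sumR_plus in HS.
  assert (sumR (fun l => vol idx (a0 l) (b0 l)) N <=
          sumR (fun l => vol idx (a0 l) (b0 l)) (Nat.max N M)).
  { apply sumR_mono; [|lia]. intros; now apply vol_nonneg. }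
  assert (sumR (fun l => vol idx (a1 l) (b1 l)) M <=
          sumR (fun l => vol idx (a1 l) (b1 l)) (Nat.max N M)).
  { apply sumR_mono; [|lia]. intros; now apply vol_nonneg. }
  lra.
Qed.

(** Outer measure need not be additive on arbitrary sets, but a cover can be cut. If the cheap half
    is the upper one, translation by [h] in direction [j] carries the lower part of [S] into it, so
    the cover can be pulled back to the lower half. *)
Lemma mle_halve {I : Type} (idx : list I) (S : (I -> R) -> Prop) (s h : R)
    (a b : I -> R) (j : I) :
  NoDup idx -> In j idx ->
  (forall X, S X -> S (fun i => X i - upd (fun _ => 0) j (- h) i)) ->
  b j = a j + 2 * h ->
  0 <= h ->
  mle idx (fun X => S X /\ inbox idx a b X) s ->
  mle idx (fun X => S X /\ inbox idx a (upd b j (a j + h)) X) (s / 2).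
Proof.
  intros Hnd Hj Hinv Hb Hh H eps He.
  (* Halving turns the slack [2 * eps] into [eps]. *)
  destruct (cov_cut idx _ (s + 2 * eps) j (a j + h) Hnd Hj (H (2 * eps) ltac:(lra)))
    as [C|C].
  - eapply cov_mono; [| |exact C]; [|lra].
    intros X [HX Hin]. split; [split; [exact HX|]|].
    + intros i Hi. specialize (Hin i Hi).
      destruct (classic (i = j)) as [->|Hij].
      * rewrite upd_eq in Hin. lra.
      * now rewrite upd_neq in Hin.
    + specialize (Hin j Hj). rewrite upd_eq in Hin. lra.
  - apply (cov_affine idx _ _ 1 (upd (fun _ => 0) j (- h))) in C; [|lra].
    rewrite pow1, Rmult_1_l in C.
    eapply cov_mono; [| |exact C]; [|lra].
    intros X [HX Hin]. cbv beta.
    replace (fun i => / 1 * (X i - upd (fun _ => 0) j (- h) i))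
      with (fun i => X i - upd (fun _ => 0) j (- h) i)
      by (apply functional_extensionality; intros; field).
    split; [split; [now apply Hinv|]|].
    + intros i Hi. specialize (Hin i Hi).
      destruct (classic (i = j)) as [->|Hij].
      * rewrite upd_eq in *. lra.
      * rewrite upd_neq in * by assumption. lra.
    + specialize (Hin j Hj). rewrite upd_eq in *. lra.
Qed.

Lemma mle_slab {I : Type} (idx : list I) (S : (I -> R) -> Prop) (s : R) (e f : nat)
    (b : I -> R) (j : I) :
  NoDup idx -> In j idx ->
  (forall X (z : I -> Z), S X -> S (fun i => X i + IZR (z i) * (/ 2) ^ e)) ->
  b j = 1 -> (f <= e)%nat ->
  mle idx (fun X => S X /\ inbox idx (fun _ => 0) b X) s ->
  mle idx (fun X => S X /\ inbox idx (fun _ => 0) (upd b j ((/ 2) ^ f)) X) ((/ 2) ^ f * s).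
Proof.
  intros Hnd Hj Hinv Hb Hf H. induction f as [|f IH].
  - simpl pow. rewrite Rmult_1_l. eapply mle_mono; [|apply Rle_refl|exact H].
    intros X [HX Hin]; split; [exact HX|]. intros i Hi. specialize (Hin i Hi).
    destruct (classic (i = j)) as [->|Hij].
    + rewrite upd_eq in Hin; lra.
    + now rewrite upd_neq in Hin.
  - specialize (IH ltac:(lia)).
    apply (mle_halve idx S _ ((/ 2) ^ Datatypes.S f) _ _ j) in IH; auto.
    + eapply mle_mono; [| |exact IH]; [|simpl; lra].
      intros X [HX Hin]; split; [exact HX|]. intros i Hi. specialize (Hin i Hi).
      destruct (classic (i = j)) as [->|Hij].
      * rewrite upd_eq in *. now rewrite Rplus_0_l.
      * now rewrite !upd_neq in *.
    + intros X HX.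
      (* The translation by [2^-(f+1)] consists of [2^(e-f-1)] steps of length [2^-e], so the
         assumed invariance applies. *)
      replace (fun i => X i - upd (fun _ => 0) j (- (/ 2) ^ Datatypes.S f) i)
        with (fun i => X i + IZR (upd (fun _ => 0%Z) j (2 ^ Z.of_nat (e - Datatypes.S f))%Z i)
                             * (/ 2) ^ e); [now apply Hinv|].
      apply functional_extensionality; intros i.
      destruct (classic (i = j)) as [->|Hij].
      * rewrite !upd_eq, <- pow_IZR.
        replace e with ((e - Datatypes.S f) + Datatypes.S f)%nat at 2 by lia.
        rewrite pow_add, <- Rmult_assoc, <- Rpow_mult_distr.
        replace (2 * / 2) with 1 by field. rewrite pow1. ring.
      * rewrite !upd_neq by assumption. ring.
    + rewrite upd_eq. simpl. lra.
    + apply pow_le. lra.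
Qed.

Lemma mle_small_cube {I : Type} (idx : list I) (S : (I -> R) -> Prop) (s : R) (e : nat) :
  NoDup idx ->
  (forall X (z : I -> Z), S X -> S (fun i => X i + IZR (z i) * (/ 2) ^ e)) ->
  mle idx (fun X => S X /\ inbox idx (fun _ => 0) (fun _ => 1) X) s ->
  mle idx (fun X => S X /\ inbox idx (fun _ => 0) (fun _ => (/ 2) ^ e) X)
    (((/ 2) ^ e) ^ length idx * s).
Proof.
  intros Hnd Hinv H.
  (* The unit cube is shrunk one coordinate at a time: [side J] has length [2^-e] in the coordinates
     of [J] and 1 in the others. *)
  set (side := fun J : list I => fold_right (fun j b => upd b j ((/ 2) ^ e)) (fun _ => 1) J).
  assert (Hin : forall J i, In i J -> side J i = (/ 2) ^ e).
  { induction J as [|j J IH]; intros i Hi; [destruct Hi|]. simpl.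
    destruct (classic (i = j)) as [->|Hij]; [now rewrite upd_eq|].
    rewrite upd_neq by assumption. apply IH. destruct Hi; congruence. }
  assert (Hout : forall J i, ~ In i J -> side J i = 1).
  { induction J as [|j J IH]; intros i Hi; [reflexivity|]. simpl.
    rewrite upd_neq by (intros ->; apply Hi; now left). apply IH.
    intros Hc; apply Hi; now right. }
  assert (HJ : forall J, NoDup J -> incl J idx ->
    mle idx (fun X => S X /\ inbox idx (fun _ => 0) (side J) X)
      (((/ 2) ^ e) ^ length J * s)).
  { intros J HJ. induction HJ as [|j J Hj HJ IH]; intros Hi.
    - simpl. now rewrite Rmult_1_l.
    - simpl length. rewrite <- tech_pow_Rmult, Rmult_assoc.
      apply (mle_slab idx S _ e e (side J) j); auto.
      + apply Hi; now left.
      + apply IH. intros i Hi'. apply Hi. now right. }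
  specialize (HJ idx Hnd (incl_refl idx)).
  eapply mle_mono; [|apply Rle_refl|exact HJ].
  intros X [HX Hb]; split; [exact HX|]. intros i Hi. rewrite Hin by assumption.
  now apply Hb.
Qed.

(** * From grid cubes to arbitrary boxes *)

Lemma mle_grid {I : Type} (idx : list I) (G : (I -> R) -> Prop) (r d : R) (o : I -> R) :
  NoDup idx -> idx <> [] -> 0 <= r -> 0 < d ->
  (forall z : I -> Z, mle idx (fun X => G X /\
      inbox idx (fun i => o i + d * IZR (z i)) (fun i => o i + d * (IZR (z i) + 1)) X)
      (r * d ^ length idx)) ->
  forall (lo : I -> Z) (w : I -> nat),
    mle idx (fun X => G X /\
      inbox idx (fun i => o i + d * IZR (lo i))
                (fun i => o i + d * (IZR (lo i) + INR (w i) + 1)) X)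
      (r * vol idx (fun i => o i + d * IZR (lo i))
                   (fun i => o i + d * (IZR (lo i) + INR (w i) + 1))).
Proof.
  intros Hnd Hne Hr Hd H.
  set (A := fun (lo : I -> Z) i => o i + d * IZR (lo i)).
  set (B := fun (lo : I -> Z) (w : I -> nat) i => o i + d * (IZR (lo i) + INR (w i) + 1)).
  assert (Hle : forall lo w, box_le idx (A lo) (B lo w)).
  { intros lo w i _. unfold A, B. apply Rplus_le_compat_l, Rmult_le_compat_l; [lra|].
    pose proof (pos_INR (w i)); lra. }
  (* [J] lists the coordinates in which the box may be more than one cube wide; since [w i] counts
     the extra cubes, [J = []] leaves a single grid cube. *)
  enough (HJ : forall J lo w, (forall i, In i idx -> ~ In i J -> w i = 0%nat) ->
      mle idx (fun X => G X /\ inbox idx (A lo) (B lo w) X) (r * vol idx (A lo) (B lo w))).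
  { intros lo w. apply (HJ idx). intros; contradiction. }
  induction J as [|j J IH].
  { intros lo w Hw.
    rewrite (vol_const idx (A lo) (B lo w) d)
      by (intros i Hi; unfold A, B; rewrite Hw by auto; simpl; ring).
    eapply mle_mono; [|apply Rle_refl|apply (H lo)].
    intros X [HX Hin]; split; [exact HX|]. intros i Hi. specialize (Hin i Hi).
    unfold A, B in Hin. rewrite (Hw i) in Hin by auto. simpl in Hin. lra. }
  destruct (classic (In j idx)) as [Hj|Hj].
  2: { intros lo w Hw. apply IH. intros i Hi HiJ. apply Hw; [exact Hi|].
       intros [->|Hc]; contradiction. }
  enough (HK : forall k lo w, w j = k ->
      (forall i, In i idx -> ~ In i (j :: J) -> w i = 0%nat) ->
      mle idx (fun X => G X /\ inbox idx (A lo) (B lo w) X) (r * vol idx (A lo) (B lo w))).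
  { intros lo w. now apply (HK (w j)). }
  assert (H0 : forall lo w, w j = 0%nat ->
      (forall i, In i idx -> ~ In i (j :: J) -> w i = 0%nat) ->
      mle idx (fun X => G X /\ inbox idx (A lo) (B lo w) X) (r * vol idx (A lo) (B lo w))).
  { intros lo w Hwj Hw. apply IH. intros i Hi HiJ.
    destruct (classic (i = j)) as [->|Hij]; [exact Hwj|].
    apply Hw; [exact Hi|]. intros [Hc|Hc]; congruence. }
  induction k as [|k IHk]; [exact H0|]. intros lo w Hwj Hw.
  (* The last layer in direction [j] is split off: [w1] describes the first [k + 1] layers, and
     [lo2], [w2] the remaining one. Only subadditivity is used, so the shared face is harmless. *)
  set (w1 := upd w j k). set (lo2 := upd lo j (lo j + Z.of_nat (S k))%Z).
  set (w2 := upd w j 0%nat).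
  assert (Hw1 : forall (v : nat) i, In i idx -> ~ In i (j :: J) -> upd w j v i = 0%nat).
  { intros v i Hi HiJ. rewrite upd_neq by (intros ->; apply HiJ; now left).
    now apply Hw. }
  pose proof (IHk lo w1 (upd_eq _ _ _) (Hw1 k)) as M1.
  pose proof (H0 lo2 w2 (upd_eq _ _ _) (Hw1 0%nat)) as M2.
  assert (V : vol idx (A lo) (B lo w) = vol idx (A lo) (B lo w1) + vol idx (A lo2) (B lo2 w2)).
  { destruct (vol_upd idx j (A lo) (B lo w) Hnd Hj) as (K & HK & ->).
    rewrite (vol_ext idx (A lo) (B lo w1) (upd (A lo) j (A lo j)) (upd (B lo w) j (B lo w1 j))).
    2: { intros i _. destruct (classic (i = j)) as [->|Hij]; [now rewrite !upd_eq|].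
         rewrite !upd_neq by assumption. unfold B, w1. now rewrite upd_neq. }
    rewrite (vol_ext idx (A lo2) (B lo2 w2) (upd (A lo) j (A lo2 j)) (upd (B lo w) j (B lo2 w2 j))).
    2: { intros i _. destruct (classic (i = j)) as [->|Hij]; [now rewrite !upd_eq|].
         rewrite !upd_neq by assumption. unfold A, B, lo2, w2. now rewrite !upd_neq. }
    rewrite !HK. unfold A, B, lo2, w2, w1. rewrite !upd_eq, Hwj, S_INR. simpl INR. ring. }
  rewrite V, Rmult_plus_distr_l.
  eapply mle_mono; [|apply Rle_refl|apply mle_union; [exact Hne| | |exact M1|exact M2]].
  - intros X [HX Hin].
    assert (Hj' : A lo2 j = B lo w1 j).
    { unfold A, B, lo2, w1. rewrite !upd_eq, plus_IZR, <- INR_IZR_INZ, S_INR. ring. }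
    destruct (Rle_dec (X j) (B lo w1 j)) as [Hc|Hc]; [left|right];
      (split; [exact HX|]); intros i Hi; specialize (Hin i Hi);
      destruct (classic (i = j)) as [->|Hij].
    + lra.
    + unfold A, B, w1 in *. rewrite !upd_neq by assumption. lra.
    + rewrite Hj'. split; [lra|]. destruct Hin as [_ Hin].
      eapply Rle_trans; [exact Hin|]. unfold B, lo2, w2.
      rewrite !upd_eq, Hwj, plus_IZR, <- INR_IZR_INZ. simpl (INR 0).
      right; ring.
    + unfold A, B, w2, lo2 in *. rewrite !upd_neq by assumption. lra.
  - apply Rmult_le_pos; [exact Hr|]. now apply vol_nonneg.
  - apply Rmult_le_pos; [exact Hr|]. now apply vol_nonneg.
Qed.

Lemma vol_mono {I : Type} (idx : list I) (a b a' b' : I -> R) :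
  box_le idx a b -> (forall i, In i idx -> b i - a i <= b' i - a' i) ->
  vol idx a b <= vol idx a' b'.
Proof.
  induction idx as [|i idx IH]; intros Hab H; simpl; [lra|].
  assert (Hab' : box_le idx a b) by (intros k Hk; apply Hab; now right).
  apply Rmult_le_compat.
  - specialize (Hab i (or_introl eq_refl)); lra.
  - now apply vol_nonneg.
  - apply H; now left.
  - apply IH; [exact Hab'|]. intros k Hk. apply H. now right.
Qed.

Lemma continuity_vol {I : Type} (idx : list I) (a b : I -> R) :
  continuity (fun d => vol idx a (fun i => b i + 2 * d)).
Proof.
  induction idx as [|i idx IH].
  - apply continuity_const. intros x y. reflexivity.
  - apply (continuity_mult (fun d => b i + 2 * d - a i)
             (fun d => vol idx a (fun i => b i + 2 * d))); [|exact IH].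
    reg.
Qed.

(** The box is enclosed in a union of grid cubes whose sides exceed its own by at most [2 * d]; as
    [d] tends to 0 the excess volume vanishes by continuity. *)
Lemma mle_box {I : Type} (idx : list I) (G : (I -> R) -> Prop) (r : R) :
  NoDup idx -> idx <> [] -> 0 <= r ->
  (forall eps, 0 < eps -> exists d o, 0 < d < eps /\
     forall z : I -> Z, mle idx (fun X => G X /\
      inbox idx (fun i => o i + d * IZR (z i)) (fun i => o i + d * (IZR (z i) + 1)) X)
      (r * d ^ length idx)) ->
  forall a b, box_le idx a b ->
    mle idx (fun X => G X /\ inbox idx a b X) (r * vol idx a b).
Proof.
  intros Hnd Hne Hr H a b Hab. apply mle_of_gt. intros s' Hs'.
  assert (Hc : exists eps, 0 < eps /\ forall d, 0 < d < eps ->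
             r * vol idx a (fun i => b i + 2 * d) < s').
  { set (f := mult_real_fct r (fun d => vol idx a (fun i => b i + 2 * d))).
    assert (Hf : continuity f) by (apply continuity_scal, continuity_vol).
    destruct (Hf 0 (s' - r * vol idx a b)) as (eps & He & Hd); [lra|].
    exists eps; split; [exact He|]. intros d Hd'.
    specialize (Hd d). unfold f, mult_real_fct in Hd. simpl in Hd.
    unfold Rdist in Hd.
    replace (fun i => b i + 2 * 0) with b in Hd
      by (apply functional_extensionality; intros; ring).
    assert (Rabs (r * vol idx a (fun i => b i + 2 * d) - r * vol idx a b)
            < s' - r * vol idx a b) as Hlt.
    { apply Hd. split; [split; [exact Logic.I|lra]|]. rewrite Rminus_0_r, Rabs_right; lra. }
    apply Rabs_def2 in Hlt. lra. }
  destruct Hc as (eps & He & Hc).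
  destruct (H eps He) as (d & o & Hd & Hz).
  pose proof (mle_grid idx G r d o Hnd Hne Hr (proj1 Hd) Hz) as Hg.
  (* [lo] indexes the grid cell of the corner [a], and [lo + w] that of [b]; the truncation in
     [Z.to_nat] is harmless since [a i <= b i] on [idx]. *)
  set (lo := fun i => Zfloor ((a i - o i) / d)).
  set (w := fun i => Z.to_nat (Zfloor ((b i - o i) / d) - lo i)).
  specialize (Hg lo w).
  assert (Hw : forall i, In i idx -> IZR (lo i) + INR (w i) = IZR (Zfloor ((b i - o i) / d))).
  { intros i Hi. unfold w. rewrite INR_IZR_INZ, Z2Nat.id.
    - rewrite minus_IZR. ring.
    - unfold lo. apply Zle_minus_le_0, Zfloor_le.
      apply Rmult_le_compat_r; [left; apply Rinv_0_lt_compat; lra|].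
      specialize (Hab i Hi); cbv beta in Hab. lra. }
  assert (Hlo : forall i, o i + d * IZR (lo i) <= a i < o i + d * IZR (lo i) + d).
  { intros i. destruct (Zfloor_bound ((a i - o i) / d)) as [L U]. fold (lo i) in L, U.
    replace (a i) with (o i + d * ((a i - o i) / d)) by (field; lra).
    set (t := (a i - o i) / d) in *. nra. }
  assert (Hhi : forall i, In i idx ->
     b i < o i + d * (IZR (lo i) + INR (w i) + 1) <= b i + d).
  { intros i Hi. rewrite Hw by exact Hi.
    destruct (Zfloor_bound ((b i - o i) / d)) as [L U].
    assert (Et : b i = o i + d * ((b i - o i) / d)) by (field; lra).
    set (t := (b i - o i) / d) in *. split; nra. }
  eapply mle_mono; [| |exact Hg].
  - intros X [HX Hin]; split; [exact HX|]. intros i Hi. specialize (Hin i Hi).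
    specialize (Hlo i). specialize (Hhi i Hi). lra.
  - apply Rle_trans with (r * vol idx a (fun i => b i + 2 * d)).
    + apply Rmult_le_compat_l; [exact Hr|]. apply vol_mono.
      * intros i Hi. specialize (Hlo i). specialize (Hhi i Hi). specialize (Hab i Hi). lra.
      * intros i Hi. specialize (Hlo i). specialize (Hhi i Hi). lra.
    + left. now apply Hc.
Qed.

(** * The infimum over covers and the zero-one criterion *)

Lemma cov_inf_exists {I : Type} (idx : list I) (S : (I -> R) -> Prop) (s : R) :
  cov idx S s -> exists r, is_inf (cov idx S) r.
Proof.
  intros Hs.
  (* Completeness provides suprema, hence the change of sign. *)
  destruct (completeness (fun x => cov idx S (- x))) as [u [Hu Hl]].
  - exists 0. intros x Hx. apply cov_nonneg in Hx. lra.
  - exists (- s). now rewrite Ropp_involutive.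
  - exists (- u). split.
    + intros t Ht. enough (- t <= u) by lra. apply Hu. now rewrite Ropp_involutive.
    + intros t Ht. enough (u <= - t) by lra. apply Hl. intros x Hx.
      specialize (Ht _ Hx). lra.
Qed.

Lemma is_inf_mle {I : Type} (idx : list I) (S : (I -> R) -> Prop) (r : R) :
  is_inf (cov idx S) r -> mle idx S r.
Proof.
  intros [Hlb Hg] eps He.
  destruct (classic (cov idx S (r + eps))) as [|Hn]; [assumption|exfalso].
  enough (r + eps <= r) by lra. apply Hg. intros s Hs.
  destruct (Rle_dec (r + eps) s) as [|Hlt]; [assumption|exfalso].
  apply Hn. eapply cov_mono; [| |exact Hs]; [auto|lra].
Qed.

Lemma is_inf_nonneg {I : Type} (idx : list I) (S : (I -> R) -> Prop) (r : R) :
  is_inf (cov idx S) r -> 0 <= r.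
Proof. intros [_ Hg]. apply Hg. intros s Hs. now apply cov_nonneg in Hs. Qed.

Lemma is_inf_le_mle {I : Type} (idx : list I) (S : (I -> R) -> Prop) (r s : R) :
  is_inf (cov idx S) r -> mle idx S s -> r <= s.
Proof.
  intros [Hlb _] Hs. apply le_epsilon. intros eps He. apply Hlb, Hs, He.
Qed.

(** [F] stands for the unit part of [G]. The density bound concerns all of [G], because the boxes of
    a cover of [F] and the grid cubes may leave the unit cube. *)
Lemma zero_one_of_grid {I : Type} (idx : list I) (G F : (I -> R) -> Prop) (r : R) :
  NoDup idx -> idx <> [] -> (forall X, F X -> G X) -> is_inf (cov idx F) r ->
  (forall eps, 0 < eps -> exists d o, 0 < d < eps /\
     forall z : I -> Z, mle idx (fun X => G X /\
      inbox idx (fun i => o i + d * IZR (z i)) (fun i => o i + d * (IZR (z i) + 1)) X)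
      (r * d ^ length idx)) ->
  r = 0 \/ 1 <= r.
Proof.
  intros Hnd Hne HFG Hinf H.
  assert (Hr : 0 <= r) by (apply (is_inf_nonneg idx F); exact Hinf).
  destruct (Req_dec r 0) as [|Hr0]; [now left|right].
  apply (proj2 Hinf). intros s (a & b & Hab & Hc & Hs).
  (* [F] lies in the union of the sets [G] cut by the boxes of the cover, and each of these has
     measure at most [r] times the volume of its box. *)
  assert (Hrs : r <= r * s).
  { apply (is_inf_le_mle idx F); [exact Hinf|].
    apply (mle_mono idx (fun X => exists l, G X /\ inbox idx (a l) (b l) X) _ (r * s)).
    - intros X HX. destruct (Hc X HX) as [l Hl]. exists l. auto.
    - lra.
    - apply (mle_countable_union idx (fun l X => G X /\ inbox idx (a l) (b l) X)
               (fun l => r * vol idx (a l) (b l))).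
      + intros l. apply mle_box; auto.
      + intros N. rewrite sumR_scal. apply Rmult_le_compat_l; auto. }
  apply Rmult_le_reg_l with r; lra.
Qed.

(** * The outer measure on matrices *)

Definition entries (n m : nat) : list (nat * nat) := list_prod (seq 0 n) (seq 0 m).

Lemma in_entries (n m i j : nat) : In (i, j) (entries n m) <-> (i < n)%nat /\ (j < m)%nat.
Proof. unfold entries. rewrite in_prod_iff, !in_seq. lia. Qed.

Lemma NoDup_entries (n m : nat) : NoDup (entries n m).
Proof.
  unfold entries. generalize 0%nat at 1. induction n as [|n IH]; intros k; simpl; [constructor|].
  apply NoDup_app.
  - apply Injective_map_NoDup; [|apply seq_NoDup]. intros x y E. now inversion E.
  - apply IH.
  - intros [i j] H1 H2. apply in_map_iff in H1 as (y & E & _). inversion E; subst.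
    apply in_prod_iff in H2 as [H2 _]. apply in_seq in H2. lia.
Qed.

Lemma entries_nonnil (n m : nat) : (1 <= n)%nat -> (1 <= m)%nat -> entries n m <> [].
Proof.
  intros Hn Hm E. assert (H : In (0%nat, 0%nat) (entries n m)) by (apply in_entries; lia).
  rewrite E in H. destruct H.
Qed.

Lemma vol_app {I : Type} (L L' : list I) (a b : I -> R) :
  vol (L ++ L') a b = vol L a b * vol L' a b.
Proof. induction L as [|i L IH]; simpl; [lra|]. rewrite IH; lra. Qed.

Lemma box_volume_vol (n m : nat) (a b : nat * nat -> R) :
  box_volume n m (fun i j => a (i, j)) (fun i j => b (i, j)) = vol (entries n m) a b.
Proof.
  assert (Hrow : forall i, prodR (fun j => b (i, j) - a (i, j)) m
                           = vol (map (fun j => (i, j)) (seq 0 m)) a b).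
  { intros i. induction m as [|m' IH]; [reflexivity|].
    rewrite seq_S, map_app, vol_app, <- IH. simpl. ring. }
  unfold box_volume, entries. rewrite list_prod_as_flat_map.
  induction n as [|n' IH]; [reflexivity|].
  rewrite seq_S, flat_map_app, vol_app, <- IH. simpl.
  rewrite app_nil_r, Hrow. reflexivity.
Qed.

Lemma sum_f_R0_sumR (f : nat -> R) (N : nat) : sum_f_R0 f N = sumR f (S N).
Proof. induction N as [|N IH]; simpl in *; [lra|]. rewrite IH. lra. Qed.

Lemma cov_of_cover_sum (n m : nat) (S : (nat -> nat -> R) -> Prop) (s : R) :
  cover_sum n m S s -> cov (entries n m) (fun Y => S (fun i j => Y (i, j))) s.
Proof.
  intros (a & b & Hab & Hc & Hs).
  assert (Hle : forall l, box_le (entries n m) (fun p => a l (fst p) (snd p))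
                                 (fun p => b l (fst p) (snd p))).
  { intros l [i j] Hij. apply in_entries in Hij as [Hi Hj]. now apply Hab. }
  assert (Hvol : forall l, box_volume n m (a l) (b l) =
             vol (entries n m) (fun p => a l (fst p) (snd p)) (fun p => b l (fst p) (snd p))).
  { intros l. apply (box_volume_vol n m (fun p => a l (fst p) (snd p))
                       (fun p => b l (fst p) (snd p))). }
  exists (fun l p => a l (fst p) (snd p)), (fun l p => b l (fst p) (snd p)).
  repeat split.
  - exact Hle.
  - intros Y HY. destruct (Hc _ HY) as [l Hl]. exists l.
    intros [i j] Hij. apply in_entries in Hij as [Hi Hj]. now apply Hl.
  - intros N.
    apply Rle_trans with (sum_f_R0 (fun l => box_volume n m (a l) (b l)) N).
    + rewrite sum_f_R0_sumR.
      apply Rle_trans with (sumR (fun l => box_volume n m (a l) (b l)) N).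
      * right. apply sumR_ext. intros l _. symmetry. apply Hvol.
      * apply sumR_mono; [|lia]. intros l.
        rewrite Hvol. now apply vol_nonneg.
    + apply sum_incr; [exact Hs|]. intros l.
      rewrite Hvol. now apply vol_nonneg.
Qed.

(** The bounded increasing partial sums converge, but possibly to a limit below [s], while
    [cover_sum] asks for the exact sum. For the infimum this makes no difference. *)
Lemma cover_sum_of_cov (n m : nat) (S : (nat -> nat -> R) -> Prop) (s : R) :
  cov (entries n m) (fun Y => S (fun i j => Y (i, j))) s ->
  exists s', s' <= s /\ cover_sum n m S s'.
Proof.
  intros (a & b & Hab & Hc & Hs).
  set (v := fun l => vol (entries n m) (a l) (b l)).
  assert (Hv : forall l, 0 <= v l) by (intros l; now apply vol_nonneg).
  assert (Hgrow : Un_growing (sum_f_R0 v)).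
  { intros N. simpl. specialize (Hv (Datatypes.S N)). lra. }
  destruct (growing_cv (sum_f_R0 v) Hgrow) as [s' Hs'].
  { exists s. intros x [N ->]. rewrite sum_f_R0_sumR. apply Hs. }
  exists s'. split.
  - destruct (Rle_dec s' s) as [|Hn]; [assumption|exfalso].
    destruct (Hs' (s' - s)) as [N HN]; [lra|]. specialize (HN N (Nat.le_refl N)).
    rewrite sum_f_R0_sumR in HN. pose proof (Hs (Datatypes.S N)). fold v in H.
    apply Rabs_def2 in HN. lra.
  - exists (fun l i j => a l (i, j)), (fun l i j => b l (i, j)). repeat split.
    + intros l i j Hi Hj. apply Hab. now apply in_entries.
    + intros X HX. destruct (Hc (fun p => X (fst p) (snd p)) HX) as [l Hl].
      exists l. intros i j Hi Hj. apply (Hl (i, j)). now apply in_entries.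
    + intros eps He. destruct (Hs' eps He) as [N HN]. exists N. intros k Hk.
      specialize (HN k Hk).
      replace (sum_f_R0 (fun l => box_volume n m (fun i j => a l (i, j))
                 (fun i j => b l (i, j))) k) with (sum_f_R0 v k); [exact HN|].
      apply sum_eq. intros l _. now rewrite box_volume_vol.
Qed.

Lemma lebesgue_outer_measure_of_cov (n m : nat) (S : (nat -> nat -> R) -> Prop) (r : R) :
  is_inf (cov (entries n m) (fun Y => S (fun i j => Y (i, j)))) r ->
  lebesgue_outer_measure n m S r.
Proof.
  intros [Hlb Hg]. split.
  - intros s Hs. apply Hlb. now apply cov_of_cover_sum.
  - intros t Ht. apply Hg. intros s Hs.
    destruct (cover_sum_of_cov n m S s Hs) as (s' & Hle & Hs').
    specialize (Ht s' Hs'). lra.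
Qed.

(** * Solutions with a restricted denominator *)

Lemma divide_gcd_list (d : Z) (l : list Z) :
  (d | gcd_list l)%Z <-> forall x, In x l -> (d | x)%Z.
Proof.
  induction l as [|y l IH]; simpl.
  - split; [contradiction|]. intros _. apply Z.divide_0_r.
  - rewrite Z.gcd_divide_iff, IH. split.
    + intros [H1 H2] x [<-|Hx]; auto.
    + intros H; split; auto.
Qed.

Lemma gcd_list_nonneg (l : list Z) : (0 <= gcd_list l)%Z.
Proof. destruct l; simpl; [lia|]. apply Z.gcd_nonneg. Qed.

(** If the gcd of [l'] is even, then 2 is a common divisor; otherwise the gcd is itself an odd one.
    Odd divisors and 2 are kept apart because Gauss's lemma serves the former and parity the
    latter. *)
Lemma gcd_list_transfer (l l' : list Z) :
  (forall d, Z.Odd d \/ d = 2%Z -> (forall x, In x l' -> (d | x)%Z) ->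
             forall x, In x l -> (d | x)%Z) ->
  gcd_list l = 1%Z -> gcd_list l' = 1%Z.
Proof.
  intros H Hl.
  assert (H1 : forall d, Z.Odd d \/ d = 2%Z -> (d | gcd_list l')%Z -> (d | 1)%Z).
  { intros d Hd Hdiv. rewrite <- Hl. apply divide_gcd_list. apply H; [exact Hd|].
    now apply divide_gcd_list. }
  destruct (Z.Even_or_Odd (gcd_list l')) as [[x Hx]|Ho].
  - exfalso. assert (2 | 1)%Z as [y Hy]; [|lia].
    apply H1; [now right|]. exists x. lia.
  - apply Z.divide_1_r_nonneg; [apply gcd_list_nonneg|].
    apply H1; [now left|]. apply Z.divide_refl.
Qed.

Lemma gcd_cond_transfer (c : variant) (m : nat) (p p' q : list Z) :
  length p = m -> length p' = m ->
  (forall d, Z.Odd d \/ d = 2%Z -> (forall x, In x q -> (d | x)%Z) ->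
     forall j, (j < m)%nat -> (d | nth j p' 0)%Z -> (d | nth j p 0)%Z) ->
  gcd_cond c m p q -> gcd_cond c m p' q.
Proof.
  intros Hp Hp' H. destruct c; cbn [gcd_cond]; [trivial| |].
  - apply gcd_list_transfer. intros d Hd Hdiv x Hx.
    apply in_app_or in Hx as [Hx|Hx]; [|apply Hdiv, in_or_app; now right].
    destruct (In_nth p x 0%Z Hx) as (j & Hj & <-).
    apply H; [exact Hd| |lia|].
    + intros y Hy. apply Hdiv, in_or_app; now right.
    + apply Hdiv, in_or_app; left. apply nth_In. lia.
  - intros Hc j Hj. apply (gcd_list_transfer (nth j p 0%Z :: q)); [|now apply Hc].
    intros d Hd Hdiv x [<-|Hx]; [|apply Hdiv; now right].
    apply H; [exact Hd| |exact Hj|].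
    + intros y Hy. apply Hdiv; now right.
    + apply Hdiv; now left.
Qed.

(** Each [y] in [L] accounts for at most one [x]. This pulls finiteness of the solution set back
    along a map of solutions. *)
Lemma finite_of_injective_rel {T U : Type} (P : T -> Prop) (Rel : T -> U -> Prop)
    (L : list U) :
  (forall x, P x -> exists y, In y L /\ Rel x y) ->
  (forall x x' y, P x -> P x' -> Rel x y -> Rel x' y -> x = x') ->
  exists L', forall x, P x -> In x L'.
Proof.
  revert P. induction L as [|y L IH]; intros P H Hinj.
  - exists []. intros x Hx. now destruct (H x Hx) as (y & [] & _).
  - destruct (IH (fun x => P x /\ ~ Rel x y)) as [L' HL'].
    + intros x [Hx Hn]. destruct (H x Hx) as (y' & [<-|Hy] & HR); [contradiction|].
      now exists y'.
    + intros x x' z [Hx _] [Hx' _]. now apply Hinj.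
    + destruct (classic (exists x, P x /\ Rel x y)) as [(x0 & Hx0 & HR0)|Hno].
      * exists (x0 :: L'). intros x Hx.
        destruct (classic (Rel x y)) as [HR|HR]; [left|right; auto].
        now apply (Hinj x0 x y).
      * exists L'. intros x Hx. apply HL'. split; [exact Hx|].
        intros HR. apply Hno. now exists x.
Qed.

(** The analogue of [F_set] on all of R^{nm}, with [q] restricted to [Q]. *)
Definition approx_set (c : variant) (n m : nat) (Psi : nat -> list Z -> R)
    (Q : list Z -> Prop) (Y : nat * nat -> R) : Prop :=
  exists k : nat, (1 <= k)%nat /\
    ~ (exists L : list (list Z * list Z), forall p q,
         Q q -> is_solution c n m Psi (INR k) (fun i j => Y (i, j)) p q -> In (p, q) L).

Lemma qXcol_affine (n : nat) (q : list Z) (t : R) (X V : nat -> nat -> R) (j : nat) :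
  qXcol n q (fun i j => t * X i j + V i j) j = t * qXcol n q X j + qXcol n q V j.
Proof.
  unfold qXcol. rewrite <- sumR_scal, <- sumR_plus. apply sumR_ext.
  intros i _. ring.
Qed.

(** With [X = t * Y + V] and [p' = t * p - qV] one has [qX + p' = t * (qY + p)]. So [(p', q)] is a
    solution for the constant [t * k], which the union over [k] absorbs. The condition on [d] keeps
    the coprimality requirement. *)
Lemma approx_set_affine (c : variant) (n m : nat) (Psi : nat -> list Z -> R)
    (Q : list Z -> Prop) (t : nat) (V Y : nat * nat -> R) :
  (1 <= t)%nat ->
  (forall q, length q = n -> Q q -> forall j, (j < m)%nat ->
     exists u : Z, qXcol n q (fun i j => V (i, j)) j = IZR u /\
       forall d, Z.Odd d \/ d = 2%Z -> (forall x, In x q -> (d | x)%Z) ->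
         forall x, (d | Z.of_nat t * x - u)%Z -> (d | x)%Z) ->
  approx_set c n m Psi Q Y -> approx_set c n m Psi Q (fun i => INR t * Y i + V i).
Proof.
  intros Ht HV (k & Hk & Hinf).
  exists (t * k)%nat. split; [nia|]. intros [L HL]. apply Hinf. clear Hinf.
  assert (Ht0 : 0 < INR t) by (apply lt_0_INR; lia).
  destruct (finite_of_injective_rel
    (fun x : list Z * list Z => Q (snd x) /\
        is_solution c n m Psi (INR k) (fun i j => Y (i, j)) (fst x) (snd x))
    (* The relation between [p] and [p'] is stated over the reals, so it needs no integer value of
       [qV]; it determines [p] since [t] is nonzero. *)
    (fun x y => snd y = snd x /\ forall j, (j < m)%nat ->
        IZR (nth j (fst y) 0%Z) =
        INR t * IZR (nth j (fst x) 0%Z) - qXcol n (snd x) (fun i j => V (i, j)) j) L)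
    as [L' HL'].
  - intros [p q] [HQ (Hq & Hp & Hex & Hlt & Hg)]; simpl in *.
    assert (Hu : exists u : nat -> Z, forall j, (j < m)%nat ->
       qXcol n q (fun i j => V (i, j)) j = IZR (u j) /\
       forall d, Z.Odd d \/ d = 2%Z -> (forall x, In x q -> (d | x)%Z) ->
         forall x, (d | Z.of_nat t * x - u j)%Z -> (d | x)%Z).
    { apply (functional_choice (fun j uj => (j < m)%nat ->
         qXcol n q (fun i j => V (i, j)) j = IZR uj /\
         forall d, Z.Odd d \/ d = 2%Z -> (forall x, In x q -> (d | x)%Z) ->
           forall x, (d | Z.of_nat t * x - uj)%Z -> (d | x)%Z)).
      intros j. destruct (Nat.lt_ge_cases j m) as [Hj|Hj].
      - destruct (HV q Hq HQ j Hj) as [u Hu]. now exists u.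
      (* The value for [j >= m] is arbitrary; it only makes [u] total. *)
      - exists 0%Z. lia. }
    destruct Hu as [u Hu].
    set (p' := map (fun j => Z.of_nat t * nth j p 0 - u j)%Z (seq 0 m)).
    assert (Hp' : length p' = m) by (unfold p'; now rewrite length_map, length_seq).
    assert (Hnth : forall j, (j < m)%nat -> nth j p' 0%Z = (Z.of_nat t * nth j p 0 - u j)%Z).
    { intros j Hj. unfold p'.
      rewrite (nth_indep _ 0%Z (Z.of_nat t * nth 0 p 0 - u 0%nat)%Z)
        by (now rewrite length_map, length_seq).
      rewrite (map_nth (fun j => Z.of_nat t * nth j p 0 - u j)%Z).
      now rewrite seq_nth. }
    assert (Hrel : forall j, (j < m)%nat -> IZR (nth j p' 0%Z) =
        INR t * IZR (nth j p 0%Z) - qXcol n q (fun i j => V (i, j)) j).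
    { intros j Hj. rewrite Hnth by exact Hj. destruct (Hu j Hj) as [-> _].
      now rewrite minus_IZR, mult_IZR, <- INR_IZR_INZ. }
    exists (p', q). split; [|now split].
    apply HL; [exact HQ|]. repeat split; auto.
    + intros j Hj. rewrite qXcol_affine, Hrel, mult_INR by exact Hj.
      match goal with |- Rabs ?e < _ => replace e with
        (INR t * (qXcol n q (fun i j => Y (i, j)) j + IZR (nth j p 0%Z))) by ring end.
      rewrite Rabs_mult, (Rabs_right (INR t)), Rmult_assoc by lra.
      apply Rmult_lt_compat_l; auto.
    + apply (gcd_cond_transfer c m p); auto.
      intros d Hd Hdq j Hj. rewrite Hnth by exact Hj.
      now apply (Hu j Hj).
  - intros [p q] [p1 q1] [p2 q2] [_ (_ & Hp & _)] [_ (_ & Hp1 & _)]; simpl in *.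
    intros [-> H1] [-> H2]. f_equal.
    apply (nth_ext p p1 0%Z 0%Z); [congruence|]. intros j Hj.
    rewrite Hp in Hj. specialize (H1 j Hj). specialize (H2 j Hj).
    apply eq_IZR. apply Rmult_eq_reg_l with (INR t); lra.
  - exists L'. intros p q HQ Hsol. now apply (HL' (p, q)).
Qed.

(** For a fixed [k], two finite lists of solutions concatenate to a finite one. With [Q1 = Q2] this
    also gives monotonicity in [Q]. *)
Lemma approx_set_cases (c : variant) (n m : nat) (Psi : nat -> list Z -> R)
    (Q Q1 Q2 : list Z -> Prop) (Y : nat * nat -> R) :
  (forall q, length q = n -> Q q -> Q1 q \/ Q2 q) ->
  approx_set c n m Psi Q Y -> approx_set c n m Psi Q1 Y \/ approx_set c n m Psi Q2 Y.
Proof.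
  intros H (k & Hk & Hinf). apply NNPP. intros Hn. apply Hinf.
  assert (HF : forall Q', ~ approx_set c n m Psi Q' Y -> exists L : list (list Z * list Z),
     forall p q, Q' q -> is_solution c n m Psi (INR k) (fun i j => Y (i, j)) p q ->
                 In (p, q) L).
  { intros Q' HQ'. apply NNPP. intros Hc. apply HQ'. now exists k. }
  destruct (HF Q1) as [L1 HL1]; [tauto|].
  destruct (HF Q2) as [L2 HL2]; [tauto|].
  exists (L1 ++ L2). intros p q HQ Hsol. apply in_or_app.
  destruct (H q (proj1 Hsol) HQ); auto.
Qed.

(** * Powers of 2 in the denominator: doubling and translation *)

Lemma gauss_pow2 (d x : Z) (e : nat) : Z.Odd d -> (d | 2 ^ Z.of_nat e * x)%Z -> (d | x)%Z.
Proof.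
  intros Hd. revert x. induction e as [|e IH]; intros x Hx.
  - now rewrite Z.mul_1_l in Hx.
  - apply IH. rewrite Nat2Z.inj_succ, Z.pow_succ_r, <- Z.mul_assoc in Hx by lia.
    apply (Z.gauss d 2); [exact Hx|].
    rewrite Z.gcd_comm. apply Zgcd_1_rel_prime. apply prime_rel_prime; [apply prime_2|].
    intros [y Hy]. destruct Hd as [w Hw]. lia.
Qed.

(** The second clause forces [i0] to be a genuine index of [q], as the default 0 is divisible by
    everything. *)
Definition exact_at (e i0 : nat) (q : list Z) : Prop :=
  (forall x, In x q -> (2 ^ Z.of_nat e | x)%Z) /\ ~ (2 ^ Z.of_nat (S e) | nth i0 q 0)%Z.

(** For [q] in [exact_at e i0], [q] times this matrix has odd integer entries. *)
Definition row_shift (e i0 : nat) (p : nat * nat) : R :=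
  if Nat.eqb (fst p) i0 then (/ 2) ^ e else 0.

Lemma sumR_single (f : nat -> R) (h : R) (n i0 : nat) :
  (i0 < n)%nat -> sumR (fun i => f i * (if Nat.eqb i i0 then h else 0)) n = f i0 * h.
Proof.
  assert (H0 : forall N, (N <= i0)%nat ->
     sumR (fun i => f i * (if Nat.eqb i i0 then h else 0)) N = 0).
  { induction N as [|N IH]; intros HN; simpl; [reflexivity|].
    rewrite IH by lia. destruct (Nat.eqb_spec N i0); [lia|ring]. }
  induction n as [|n IH]; intros Hn; [lia|]. simpl.
  destruct (Nat.eqb_spec n i0) as [->|Hne].
  - rewrite H0 by lia. ring.
  - rewrite IH by lia. ring.
Qed.

Lemma pow2_inv (e : nat) : IZR (2 ^ Z.of_nat e) * (/ 2) ^ e = 1.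
Proof.
  rewrite <- pow_IZR, <- Rpow_mult_distr. replace (2 * / 2) with 1 by field. apply pow1.
Qed.

Lemma approx_set_double (c : variant) (n m e i0 : nat) (Psi : nat -> list Z -> R)
    (Y : nat * nat -> R) :
  (i0 < n)%nat -> approx_set c n m Psi (exact_at e i0) Y ->
  approx_set c n m Psi (exact_at e i0) (fun i => 2 * Y i + row_shift e i0 i).
Proof.
  intros Hi0. apply (approx_set_affine c n m Psi _ 2); [lia|].
  intros q Hq [Hdiv Hnd] j Hj.
  destruct (Hdiv (nth i0 q 0%Z)) as [u Hu]; [apply nth_In; lia|].
  exists u. split.
  - unfold qXcol, row_shift. simpl fst.
    rewrite (sumR_single (fun i => IZR (nth i q 0%Z))) by exact Hi0.
    rewrite Hu, mult_IZR, Rmult_assoc, pow2_inv. ring.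
  - intros d [Hd| ->] Hdq x Hx.
    (* Here [u] is [q_i0 / 2^e]: an odd [d] dividing [q] divides [u], hence [2x], hence [x]. *)
    + assert (Hdu : (d | u)%Z).
      { apply (gauss_pow2 d u e Hd). rewrite Z.mul_comm, <- Hu. apply Hdq, nth_In. lia. }
      apply (gauss_pow2 d x 1 Hd). change (2 ^ Z.of_nat 1)%Z with (Z.of_nat 2).
      replace (Z.of_nat 2 * x)%Z with (Z.of_nat 2 * x - u + u)%Z by ring.
      now apply Z.divide_add_r.
    (* If 2 divided [2x - u], then [u] would be even and [2^(e+1)] would divide [q_i0]. *)
    + exfalso. apply Hnd. destruct Hx as [y Hy].
      exists (x - y)%Z. rewrite Hu, Nat2Z.inj_succ, Z.pow_succ_r by lia. nia.
Qed.

(** Here [p] changes by [qV], which must be divisible by every common divisor of [q] that is odd or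
    2. The parity clause on [v] handles 2 and covers both uses: [e = 0], and [q] divisible by
    [2^(e+1)]. *)
Lemma approx_set_translate (c : variant) (n m e : nat) (Psi : nat -> list Z -> R)
    (Q : list Z -> Prop) (z : nat * nat -> Z) (Y : nat * nat -> R) :
  (forall q, length q = n -> Q q -> forall i, (i < n)%nat ->
     exists v, nth i q 0%Z = (2 ^ Z.of_nat e * v)%Z /\ ((2 | nth i q 0) -> (2 | v))%Z) ->
  approx_set c n m Psi Q Y ->
  approx_set c n m Psi Q (fun i => Y i + IZR (z i) * (/ 2) ^ e).
Proof.
  intros HQ HY.
  replace (fun i => Y i + IZR (z i) * (/ 2) ^ e)
    with (fun i => INR 1 * Y i + IZR (z i) * (/ 2) ^ e)
    by (apply functional_extensionality; intros; simpl; ring).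
  revert HY. apply (approx_set_affine c n m Psi _ 1); [lia|].
  intros q Hq HQq j Hj. specialize (HQ q Hq HQq).
  (* Induction on the number of rows summed; [d] is still required to divide all of [q]. *)
  enough (HN : forall N, (N <= n)%nat -> exists u : Z,
     qXcol N q (fun i j => IZR (z (i, j)) * (/ 2) ^ e) j = IZR u /\
     forall d, Z.Odd d \/ d = 2%Z -> (forall x, In x q -> (d | x)%Z) -> (d | u)%Z).
  { destruct (HN n (Nat.le_refl n)) as (u & Hu & Hd). exists u. split; [exact Hu|].
    intros d Hd' Hdq x Hx. specialize (Hd d Hd' Hdq).
    replace x with (Z.of_nat 1 * x - u + u)%Z by lia. now apply Z.divide_add_r. }
  induction N as [|N IH]; intros HN.
  - exists 0%Z. split; [reflexivity|]. intros; apply Z.divide_0_r.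
  - destruct IH as (u & Hu & Hd); [lia|].
    destruct (HQ N HN) as (v & Hv & Hv2).
    exists (u + v * z (N, j))%Z. split.
    + unfold qXcol in *. simpl. rewrite Hu, Hv, plus_IZR, !mult_IZR.
      pose proof (pow2_inv e) as E.
      transitivity (IZR u + IZR v * IZR (z (N, j)) * (IZR (2 ^ Z.of_nat e) * (/ 2) ^ e));
        [ring|rewrite E; ring].
    + intros d Hd' Hdq. apply Z.divide_add_r; [now apply Hd|]. apply Z.divide_mul_l.
      assert (HdN : (d | nth N q 0)%Z) by (apply Hdq, nth_In; lia).
      destruct Hd' as [Ho| ->]; [|now apply Hv2].
      apply (gauss_pow2 d v e Ho). now rewrite <- Hv.
Qed.

Lemma approx_set_translate_int (c : variant) (n m : nat) (Psi : nat -> list Z -> R)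
    (Q : list Z -> Prop) (z : nat * nat -> Z) (Y : nat * nat -> R) :
  approx_set c n m Psi Q Y -> approx_set c n m Psi Q (fun i => Y i + IZR (z i)).
Proof.
  intros HY. apply (approx_set_translate c n m 0 Psi Q z) in HY.
  - replace (fun i => Y i + IZR (z i)) with (fun i => Y i + IZR (z i) * (/ 2) ^ 0)
      by (apply functional_extensionality; intros; simpl; ring).
    exact HY.
  - intros q _ _ i _. exists (nth i q 0%Z). split; [|auto].
    change (2 ^ Z.of_nat 0)%Z with 1%Z. ring.
Qed.

Lemma approx_set_translate_pow2 (c : variant) (n m e : nat) (Psi : nat -> list Z -> R)
    (z : nat * nat -> Z) (Y : nat * nat -> R) :
  let Q := fun q => forall x, In x q -> (2 ^ Z.of_nat (S e) | x)%Z in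
  approx_set c n m Psi Q Y ->
  approx_set c n m Psi Q (fun i => Y i + IZR (z i) * (/ 2) ^ e).
Proof.
  intros Q. apply approx_set_translate. intros q Hq HQ i Hi.
  destruct (HQ (nth i q 0%Z)) as [v Hv]; [apply nth_In; lia|].
  exists (2 * v)%Z. split.
  - rewrite Hv, Nat2Z.inj_succ, Z.pow_succ_r by lia. ring.
  - intros _. apply Z.divide_factor_l.
Qed.

(** This is the [k]-th iterate of the doubling map, which fixes [-V] and therefore sends [X + V] to
    [2 (X + V)]. *)
Lemma approx_set_dilate (c : variant) (n m e i0 k : nat) (Psi : nat -> list Z -> R)
    (Y : nat * nat -> R) :
  (i0 < n)%nat -> approx_set c n m Psi (exact_at e i0) Y ->
  approx_set c n m Psi (exact_at e i0)
    (fun i => 2 ^ k * Y i + (2 ^ k - 1) * row_shift e i0 i).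
Proof.
  intros Hi0 HY. induction k as [|k IH].
  - replace (fun i => 2 ^ 0 * Y i + (2 ^ 0 - 1) * row_shift e i0 i) with Y; [exact HY|].
    apply functional_extensionality; intros; simpl; ring.
  - apply approx_set_double in IH; [|exact Hi0].
    replace (fun i => 2 ^ S k * Y i + (2 ^ S k - 1) * row_shift e i0 i)
      with (fun i => 2 * (2 ^ k * Y i + (2 ^ k - 1) * row_shift e i0 i)
                     + row_shift e i0 i); [exact IH|].
    apply functional_extensionality; intros; simpl; ring.
Qed.

(** * The zero-one law *)

Definition unit_part {I : Type} (idx : list I) (G : (I -> R) -> Prop) (Y : I -> R) : Prop :=
  G Y /\ inbox idx (fun _ => 0) (fun _ => 1) Y.

Lemma cov_unit_part {I : Type} (idx : list I) (G : (I -> R) -> Prop) :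
  idx <> [] -> cov idx (unit_part idx G) 1.
Proof.
  intros Hne.
  apply (cov_mono idx (inbox idx (fun _ => 0) (fun _ => 1)) _
           (vol idx (fun _ => 0) (fun _ => 1))).
  - intros X [_ HX]; exact HX.
  - rewrite (vol_const idx _ _ 1) by (intros; ring). rewrite pow1. lra.
  - apply cov_box; [exact Hne|]. intros i _; lra.
Qed.

Lemma half_pow_small (eps : R) : 0 < eps -> exists k, 0 < (/ 2) ^ k < eps.
Proof.
  intros He. destruct (pow_lt_1_zero (/ 2) ltac:(rewrite Rabs_right; lra) eps He) as [k Hk].
  exists k. assert (0 < (/ 2) ^ k) by (apply pow_lt; lra).
  specialize (Hk k (Nat.le_refl k)). rewrite Rabs_right in Hk; lra.
Qed.

Lemma approx_set_exact_grid (c : variant) (n m e i0 : nat) (Psi : nat -> list Z -> R) (r : R) :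
  (i0 < n)%nat ->
  mle (entries n m) (unit_part (entries n m) (approx_set c n m Psi (exact_at e i0))) r ->
  forall eps, 0 < eps -> exists d o, 0 < d < eps /\
    forall z : nat * nat -> Z, mle (entries n m)
      (fun X => approx_set c n m Psi (exact_at e i0) X /\
         inbox (entries n m) (fun i => o i + d * IZR (z i))
                             (fun i => o i + d * (IZR (z i) + 1)) X)
      (r * d ^ length (entries n m)).
Proof.
  intros Hi0 Hr eps He.
  destruct (half_pow_small eps He) as [k Hk].
  (* The offset is chosen so that the [k]-th iterate, followed by translation by [-z], maps the cube
     of index [z] onto the unit cube. *)
  exists ((/ 2) ^ k), (fun i => - ((2 ^ k - 1) * row_shift e i0 i) * (/ 2) ^ k).
  split; [exact Hk|]. intros z.
  set (d := (/ 2) ^ k) in *.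
  set (o := fun i => - ((2 ^ k - 1) * row_shift e i0 i) * d).
  apply (mle_affine _ _ _ d (fun i => o i + d * IZR (z i))) in Hr; [|apply Hk].
  eapply mle_mono; [| |exact Hr]; [|right; ring].
  intros X [HX Hin]. cbv beta. split.
  - apply (approx_set_dilate c n m e i0 k) in HX; [|exact Hi0].
    apply (approx_set_translate_int c n m Psi _ (fun i => (- z i)%Z)) in HX.
    match goal with |- ?G ?f => match type of HX with _ ?g => replace f with g; [exact HX|] end end.
    apply functional_extensionality; intros i. unfold o. rewrite opp_IZR.
    assert (Ed : 2 ^ k = / d) by (unfold d; rewrite pow_inv; field; apply pow_nonzero; lra).
    rewrite Ed. field. lra.
  - intros i Hi. specialize (Hin i Hi). simpl in Hin. fold d in Hin. fold (o i) in Hin.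
    set (y := o i + d * IZR (z i)) in *.
    split.
    + apply Rmult_le_pos; [left; apply Rinv_0_lt_compat|]; lra.
    + apply Rmult_le_reg_l with d; [lra|]. rewrite <- Rmult_assoc, Rinv_r by lra.
      rewrite Rmult_1_l, Rmult_1_r. unfold y in *. lra.
Qed.

(** All boxes are considered, not just the unit cube, since the grid cubes lie anywhere in space. *)
Definition null_on_boxes {I : Type} (idx : list I) (S : (I -> R) -> Prop) : Prop :=
  forall a b, box_le idx a b -> mle idx (fun X => S X /\ inbox idx a b X) 0.

Lemma null_on_boxes_union {I : Type} (idx : list I) (S S1 S2 : (I -> R) -> Prop) :
  idx <> [] -> (forall X, S X -> S1 X \/ S2 X) ->
  null_on_boxes idx S1 -> null_on_boxes idx S2 -> null_on_boxes idx S.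
Proof.
  intros Hne H H1 H2 a b Hab.
  apply (mle_mono idx (fun X => (S1 X /\ inbox idx a b X) \/ (S2 X /\ inbox idx a b X))
           _ (0 + 0)).
  - intros X [HX Hin]. destruct (H X HX); auto.
  - lra.
  - apply mle_union; auto; lra.
Qed.

Lemma null_on_boxes_empty {I : Type} (idx : list I) (S : (I -> R) -> Prop) :
  idx <> [] -> (forall X, ~ S X) -> null_on_boxes idx S.
Proof.
  intros Hne H a b _. eapply mle_mono; [|apply Rle_refl|apply mle_False; exact Hne].
  intros X [HX _]. now apply (H X).
Qed.

Lemma approx_set_empty (c : variant) (n m : nat) (Psi : nat -> list Z -> R)
    (Q : list Z -> Prop) (Y : nat * nat -> R) :
  (forall q, length q = n -> ~ Q q) -> ~ approx_set c n m Psi Q Y.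
Proof.
  intros H (k & _ & Hinf). apply Hinf. exists []. intros p q HQ Hsol.
  exfalso. now apply (H q (proj1 Hsol)).
Qed.

(** If [2^e] does not divide [q], the exact power of 2 dividing [q] has a smaller exponent and is
    attained at some coordinate. So finitely many classes suffice. *)
Lemma null_not_pow2 (c : variant) (n m : nat) (Psi : nat -> list Z -> R) :
  entries n m <> [] ->
  (forall e i0, (i0 < n)%nat ->
     null_on_boxes (entries n m) (approx_set c n m Psi (exact_at e i0))) ->
  forall e, null_on_boxes (entries n m)
    (approx_set c n m Psi (fun q => ~ forall x, In x q -> (2 ^ Z.of_nat e | x)%Z)).
Proof.
  intros Hne H.
  assert (HN : forall e N, (N <= n)%nat -> null_on_boxes (entries n m)
    (approx_set c n m Psi (fun q => exists i0, (i0 < N)%nat /\ exact_at e i0 q))).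
  { intros e. induction N as [|N IH]; intros HN.
    - apply null_on_boxes_empty; [exact Hne|]. intros X. apply approx_set_empty.
      intros q _ (i0 & Hi0 & _). lia.
    - apply (null_on_boxes_union _ _ (approx_set c n m Psi (exact_at e N))
        (approx_set c n m Psi (fun q => exists i0, (i0 < N)%nat /\ exact_at e i0 q)));
        [exact Hne| |apply H; lia|apply IH; lia].
      intros X. apply approx_set_cases. intros q _ (i0 & Hi0 & Hex).
      destruct (Nat.eq_dec i0 N) as [->|]; [now left|right]. exists i0. split; [lia|exact Hex]. }
  induction e as [|e IH].
  - apply null_on_boxes_empty; [exact Hne|]. intros X. apply approx_set_empty.
    intros q _ Hc. apply Hc. intros x _. apply Z.divide_1_l.
  - eapply null_on_boxes_union; [exact Hne| |exact IH|apply (HN e n (Nat.le_refl n))].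
    intros X. apply approx_set_cases. intros q Hq Hc.
    destruct (classic (forall x, In x q -> (2 ^ Z.of_nat e | x)%Z)) as [Hd|Hd]; [right|now left].
    apply not_all_ex_not in Hc as [x Hx]. apply imply_to_and in Hx as [Hx Hx'].
    destruct (In_nth q x 0%Z Hx) as (i & Hi & <-).
    exists i. split; [lia|]. now split.
Qed.

Lemma approx_set_zero_one (c : variant) (n m : nat) (Psi : nat -> list Z -> R) (r : R) :
  (1 <= n)%nat -> (1 <= m)%nat ->
  is_inf (cov (entries n m) (unit_part (entries n m) (approx_set c n m Psi (fun _ => True)))) r ->
  r = 0 \/ r = 1.
Proof.
  intros Hn Hm Hr.
  assert (Hne := entries_nonnil n m Hn Hm). assert (Hnd := NoDup_entries n m).
  assert (Hle1 : r <= 1) by (apply (proj1 Hr), cov_unit_part, Hne).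
  enough (r = 0 \/ 1 <= r) by lra.
  set (idx := entries n m) in *.
  (* Either some class already fills the unit cube in outer measure, and then so does the larger
     full set, or every class is null by its own zero-one law. *)
  destruct (classic (exists e i0 s, (i0 < n)%nat /\ 1 <= s /\
      is_inf (cov idx (unit_part idx (approx_set c n m Psi (exact_at e i0)))) s))
    as [(e & i0 & s & Hi0 & Hs1 & Hs)|Hnull].
  { right. apply (proj2 Hr). intros t Ht. apply Rle_trans with s; [exact Hs1|].
    apply (proj1 Hs). eapply cov_mono; [|apply Rle_refl|exact Ht].
    intros X [HX Hin]; split; [|exact Hin].
    destruct (approx_set_cases c n m Psi (exact_at e i0) (fun _ => True) (fun _ => True) X)
      as [|]; auto. }
  assert (Hnull' : forall e i0, (i0 < n)%nat ->
     null_on_boxes idx (approx_set c n m Psi (exact_at e i0))).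
  { intros e i0 Hi0.
    destruct (cov_inf_exists idx (unit_part idx (approx_set c n m Psi (exact_at e i0))) 1)
      as [s Hs]; [now apply cov_unit_part|].
    pose proof (approx_set_exact_grid c n m e i0 Psi s Hi0 (is_inf_mle _ _ _ Hs)) as Hg.
    fold idx in Hg.
    destruct (zero_one_of_grid idx (approx_set c n m Psi (exact_at e i0)) _ s Hnd Hne
      (fun X => @proj1 _ _) Hs Hg) as [->|Hs1].
    - intros a b Hab. rewrite <- (Rmult_0_l (vol idx a b)).
      apply mle_box; auto. lra.
    - exfalso. apply Hnull. now exists e, i0, s. }
  apply (zero_one_of_grid idx (approx_set c n m Psi (fun _ => True)) _ r Hnd Hne
           (fun X => @proj1 _ _) Hr).
  intros eps He. destruct (half_pow_small eps He) as [e Hd].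
  (* The grid of side [2^-e] based at the origin; the solutions kept are those with [2^(e+1)]
     dividing [q]. *)
  exists ((/ 2) ^ e), (fun _ => 0). split; [exact Hd|]. intros z.
  set (d := (/ 2) ^ e) in *.
  set (Q := fun q => forall x, In x q -> (2 ^ Z.of_nat (S e) | x)%Z).
  assert (HQ : mle idx (fun X => approx_set c n m Psi Q X /\
             inbox idx (fun _ => 0) (fun _ => d) X) (d ^ length idx * r)).
  { apply mle_small_cube; [exact Hnd| |].
    - intros X w. apply (approx_set_translate_pow2 c n m e Psi w X).
    - eapply mle_mono; [|apply Rle_refl|apply is_inf_mle; exact Hr].
      intros X [HX Hin]; split; [|exact Hin].
      destruct (approx_set_cases c n m Psi Q (fun _ => True) (fun _ => True) X) as [|]; auto. }
  (* The bound for the cube at the origin is moved to the cube of index [z]; invariance under [-z]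
     later brings the points of that cube back. *)
  apply (mle_translate idx _ _ (fun i => d * IZR (z i))) in HQ.
  assert (Hr0 := is_inf_nonneg _ _ _ Hr).
  assert (Hdp : 0 <= d ^ length idx) by (apply pow_le; lra).
  assert (Hbox : box_le idx (fun i => 0 + d * IZR (z i)) (fun i => 0 + d * (IZR (z i) + 1)))
    by (intros i _; nra).
  eapply mle_mono; [| |apply mle_union; [exact Hne| | |
    exact (null_not_pow2 c n m Psi Hne Hnull' (S e) _ _ Hbox)|exact HQ]].
  - intros X [HX Hin]. cbv beta.
    destruct (approx_set_cases c n m Psi (fun _ => True) (fun q => ~ Q q) Q X) as [H|H];
      [intros q _ _; destruct (classic (Q q)); auto|exact HX| |].
    + left. split; [exact H|exact Hin].
    + right. split.
      * apply (approx_set_translate_pow2 c n m e Psi (fun i => (- z i)%Z)) in H.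
        match goal with |- ?G ?f => match type of H with _ ?g => replace f with g; [exact H|] end end.
        apply functional_extensionality; intros i. fold d. rewrite opp_IZR. ring.
      * intros i Hi. specialize (Hin i Hi). simpl in Hin. lra.
  - right; ring.
  - lra.
  - apply Rmult_le_pos; assumption.
Qed.

Theorem mainTheorem7 (n m : nat) (hn : (1 <= n)%nat) (hm : (1 <= m)%nat)
    (Psi : nat -> list Z -> R)
    (hPsi : forall j q, (j < m)%nat -> length q = n -> 0 < Psi j q)
    (c : variant) :
  exists r, lebesgue_outer_measure n m (F_set c n m Psi) r /\ (r = 0 \/ r = 1).
Proof.
  assert (Hne := entries_nonnil n m hn hm).
  set (idx := entries n m) in *.
  destruct (cov_inf_exists idx (unit_part idx (approx_set c n m Psi (fun _ => True))) 1)
    as [r Hr]; [now apply cov_unit_part|].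
  exists r. split; [|exact (approx_set_zero_one c n m Psi r hn hm Hr)].
  apply lebesgue_outer_measure_of_cov. fold idx.
  (* The cube condition does not depend on [k], so it can be moved out of the union defining
     [F_set]. *)
  replace (fun Y : nat * nat -> R => F_set c n m Psi (fun i j => Y (i, j)))
    with (unit_part idx (approx_set c n m Psi (fun _ => True))); [exact Hr|].
  apply functional_extensionality; intros Y. apply propositional_extensionality.
  unfold unit_part, approx_set, F_set, A_set, in_unit_cube. split.
  - intros [(k & Hk & Hinf) Hin]. exists k. split; [exact Hk|]. split.
    + intros i j Hi Hj. apply (Hin (i, j)). now apply in_entries.
    + intros [L HL]. apply Hinf. exists L. intros p q _. apply HL.
  - intros (k & Hk & Hin & Hinf). split.
    + exists k. split; [exact Hk|]. intros [L HL]. apply Hinf. exists L.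
      intros p q. now apply HL.
    + intros [i j] Hij. apply in_entries in Hij as [Hi Hj]. now apply Hin.
Qed.
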